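(* Let $I$ be a nonempty set, let $\mathcal{H}_I$ be the associated Heisenberg Lie algebra and let $\mathcal{F}$ be the category of restricted $\mathcal{H}_I$-modules of level $1$ on which $\mathbf{p}_i$ acts locally finitely for every $i\in I$. Then every irreducible $\mathcal{H}_I$-module in the category $\mathcal{F}$ is isomorphic to $M(1,\lambda)$ for some $\lambda\in F^0(I,\mathbb{C})$, and every $\mathcal{H}_I$-module in the category $\mathcal{F}$ is completely reducible.
   Context: All vector spaces are over $\mathbb{C}$. For a nonempty set $I$, $\mathcal{H}_I$ is the Lie algebra with basis $\{\mathbf{p}_i,\mathbf{q}_i,\mathbf{k}\mid i\in I\}$ and brackets $[\mathbf{k},\mathcal{H}_I]=0$, $[\mathbf{p}_i,\mathbf{p}_j]=0=[\mathbf{q}_i,\mathbf{q}_j]$, $[\mathbf{p}_i,\mathbf{q}_j]=\delta_{ij}\mathbf{k}$ for $i,j\in I$. An $\mathcal{H}_I$-module is of level $\ell\in\mathbb{C}$ if $\mathbf{k}$ acts as the scalar $\ell$. An $\mathcal{H}_I$-module $W$ is restricted if for every $w\in W$, $\mathbf{p}_iw=0$ for all but finitely many $i\in I$. An operator on $W$ is locally finite if every vector of $W$ lies in a finite-dimensional subspace stable under the operator. $F^0(I,\mathbb{C})$ is the set of functions $\mu:I\to\mathbb{C}$, $i\mapsto\mu_i$, with $\mu_i=0$ for all but finitely many $i\in I$. Let $x_i$ $(i\in I)$ be mutually commuting independent variables. For $\lambda\in F^0(I,\mathbb{C})$ put $\lambda\mathbf{x}=\sum_{i\in I}\lambda_ix_i$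 and $M(1,\lambda)=e^{\lambda\mathbf{x}}\,\mathbb{C}[x_i\mid i\in I]$, a space of functions in the $x_i$, which is an $\mathcal{H}_I$-module with $\mathbf{p}_i$ acting as $\partial/\partial x_i$, $\mathbf{q}_i$ as multiplication by $x_i$, and $\mathbf{k}$ as the identity. *)

(* Defs.v *)
From HB Require Import structures.
From mathcomp Require Import all_boot all_order all_algebra.
From mathcomp Require Import finmap complex.
From mathcomp Require Import all_classical all_reals all_analysis.
From mathcomp Require Import ring lra.
Import Order.TTheory GRing.Theory Num.Theory.
Import numFieldNormedType.Exports.
Set Implicit Arguments.
Unset Strict Implicit.
Unset Printing Implicit Defensive.
Local Open Scope classical_set_scope.
Local Open Scope ring_scope.

Record lieAlgebra (K : fieldType) := LieAlgebra {
  lie_sort :> lmodType K;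
  lie_bracket : {bilinear lie_sort -> lie_sort -> lie_sort};
  lie_alternating : forall x, lie_bracket x x = 0;
  lie_jacobi : forall x y z,
    lie_bracket x (lie_bracket y z) + lie_bracket y (lie_bracket z x)
      + lie_bracket z (lie_bracket x y) = 0
}.

Arguments lie_bracket {K} L : rename.

Record lieModule (K : fieldType) (L : lieAlgebra K) := LieModule {
  lmod_sort :> lmodType K;
  lie_act : {bilinear L -> lmod_sort -> lmod_sort};
  lie_actB : forall x y v,
    lie_act (lie_bracket L x y) v
      = lie_act x (lie_act y v) - lie_act y (lie_act x v)
}.

Arguments lie_act {K L l}.

Section LieModuleTheory.
Variables (K : fieldType) (L : lieAlgebra K).

Definition lie_isomorphic (V W : lieModule L) : Prop :=
  exists f : {linear V -> W},
    bijective f /\ forall x v, f (lie_act x v) = lie_act x (f v).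

Variable W : lieModule L.

Definition lie_submodule (U : set W) : Prop :=
  submod_closed [in U] /\ forall x u, U u -> U (lie_act x u).

(* [irreducible_submodule U]: U is a submodule which is irreducible as a
   module, i.e. nonzero and without nontrivial proper submodules. *)
Definition irreducible_submodule (U : set W) : Prop :=
  [/\ lie_submodule U, U <> [set 0] &
    forall V, lie_submodule V -> V `<=` U -> V = [set 0] \/ V = U].

Definition lie_irreducible : Prop := irreducible_submodule [set: W].

(* W is the internal direct sum of a (possibly empty) family of irreducible
   submodules: every w is in a unique way a sum of a finitely supported family
   (u j) with u j in U j. *)
Definition completely_reducible : Prop :=
  exists (J : choiceType) (U : J -> set W),
    (forall j, irreducible_submodule (U j)) /\
    forall w, exists! u : J -> W,
      [/\ forall j, U j (u j), finite_set [set j | u j != 0] &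
          w = \sum_(j \in [set: J]) u j].

End LieModuleTheory.

Section LocallyFinite.
Variables (K : fieldType) (V : lmodType K).

Definition finite_dimensional (U : set V) : Prop :=
  exists s : seq V,
    U = range (fun c : 'I_(size s) -> K => \sum_(i < size s) c i *: s`_i).

Definition locally_finite (T : V -> V) : Prop :=
  forall v, exists U : set V,
    [/\ finite_dimensional U, U v & forall u, U u -> U (T u)].

End LocallyFinite.

Section FiniteSupport.
Variables (K : fieldType) (T : choiceType).

(* [K^o] is K seen as a module over itself; it gives [T -> K^o] its pointwise
   vector space structure. *)
Definition finsupp : {pred T -> K^o} :=
  fun f => `[< finite_set [set t | f t != 0] >].

(* F^0(T, K): the finitely supported functions T -> K; for any set T this is
   also the vector space with basis (delta t), t in T. *)
Record F0 := MkF0 { F0val : T -> K^o; F0valP : F0val \in finsupp }.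
Definition F0_fun (f : F0) : T -> K := F0val f.
Coercion F0_fun : F0 >-> Funclass.

HB.instance Definition _ := [isSub for F0val].
HB.instance Definition _ := [Choice of F0 by <:].

Lemma F0_finite (f : F0) : finite_set [set t | f t != 0].
Proof. exact/asboolP/(F0valP f). Qed.

Lemma finsupp_submod : submod_closed finsupp.
Proof.
split; first by apply/asboolP; rewrite (_ : mkset _ = set0) // -subset0 => t /=;
  rewrite eqxx.
move=> a f g /asboolP ff /asboolP fg; apply/asboolP.
apply: (@sub_finite_set _ _ ([set t | f t != 0] `|` [set t | g t != 0])).
  move=> t; apply: contraPP => /not_orP[/negP/negPn/eqP ft /negP/negPn/eqP gt].
  by rewrite /= -[(_ + _) t]/(a * f t + g t) ft gt mulr0 addr0 eqxx.
by rewrite finite_setU.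
Qed.
HB.instance Definition _ := GRing.isSubmodClosed.Build K (T -> K^o) finsupp
  finsupp_submod.
HB.instance Definition _ := [SubChoice_isSubLmodule of F0 by <:].

Lemma F0_linE a (f g : F0) t : (a *: f + g) t = a * f t + g t.
Proof. by []. Qed.

Lemma F0P (f g : F0) : f =1 g -> f = g.
Proof. by move=> fg; apply/val_inj/funext. Qed.

Lemma F0_sumE J (s : seq J) (c : J -> K) (G : J -> F0) t :
  (\sum_(j <- s) c j *: G j) t = \sum_(j <- s) c j * G j t.
Proof.
elim: s => [|j s IH]; first by rewrite !big_nil.
by rewrite !big_cons F0_linE IH.
Qed.

End FiniteSupport.

Lemma linear_bundle (K : fieldType) (V W : lmodType K) (f : V -> W) :
  linear f -> exists g : {linear V -> W}, f = g.
Proof.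
move=> lf; pose m := GRing.isLinear.Build K V W _ f lf.
by exists (HB.pack f m : {linear V -> W}).
Qed.

Section LinearCombination.
Variables (K : fieldType) (T : choiceType).
Implicit Types (x y : F0 K T) (V : lmodType K).

(* The linear extension to F0 K T of F : T -> V, evaluated at x. *)
Definition lincomb V x (F : T -> V) : V := \sum_(t \in [set: T]) x t *: F t.

Lemma lincombE (D : set T) V x (F : T -> V) : finite_set D ->
  [set t | x t != 0] `<=` D -> lincomb x F = \sum_(t <- fset_set D) x t *: F t.
Proof.
move=> fD xD; rewrite /lincomb -(fsbig_widen D)//; first exact: fsbig_finite.
move=> t [_ Dt] /=; have [->|xt] := eqVneq (x t) 0; first by rewrite scale0r.
by case: Dt; exact: xD.
Qed.

Lemma lincombP V x : exists s : seq T,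
  forall F : T -> V, lincomb x F = \sum_(t <- s) x t *: F t.
Proof.
exists (fset_set [set t | x t != 0]) => F.
by apply: lincombE => //; exact: F0_finite.
Qed.

Lemma lincombPl V a x y (F : T -> V) :
  lincomb (a *: x + y) F = a *: lincomb x F + lincomb y F.
Proof.
pose D := [set t | x t != 0] `|` [set t | y t != 0].
have fD : finite_set D by rewrite finite_setU; split; exact: F0_finite.
have xD : [set t | x t != 0] `<=` D by left.
have yD : [set t | y t != 0] `<=` D by right.
have xyD : [set t | (a *: x + y) t != 0] `<=` D.
  move=> t; apply: contraPP => /not_orP[/negP/negPn/eqP xt /negP/negPn/eqP yt].
  apply/negP; rewrite negbK; apply/eqP.
  by transitivity (a * x t + y t) => //; rewrite xt yt mulr0 addr0.
rewrite !(lincombE _ fD)// scaler_sumr -big_split; apply: eq_bigr => t _.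
rewrite scalerA /=; exact: (scalerDl (F t) (a * x t) (y t)).
Qed.

Lemma lincombPr V a x (F G : T -> V) :
  lincomb x (fun t => a *: F t + G t) = a *: lincomb x F + lincomb x G.
Proof.
have [s E] := lincombP V x; rewrite !E scaler_sumr -big_split.
by apply: eq_bigr => t _; rewrite scalerDr !scalerA mulrC.
Qed.

Lemma lincomb0 V x (F : T -> V) : (forall t, F t = 0) -> lincomb x F = 0.
Proof.
by move=> F0; have [s ->] := lincombP V x; rewrite big1// => t _; rewrite F0 scaler0.
Qed.

Lemma lincomb_linear V (W : lmodType K) (f : V -> W) x (F : T -> V) :
  linear f -> f (lincomb x F) = lincomb x (f \o F).
Proof.
move=> /linear_bundle[g ->].
rewrite !(lincombE _ (F0_finite x))// linear_sum.
by apply: eq_bigr => t _; rewrite linearZ.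
Qed.

Lemma lincomb_exchange V x y (F : T -> T -> V) :
  lincomb x (fun s => lincomb y (F s)) = lincomb y (fun t => lincomb x (F^~ t)).
Proof.
have [r E] := lincombP V x; have [s E'] := lincombP V y; rewrite !E !E'.
under eq_bigr do rewrite E' scaler_sumr.
rewrite exchange_big; apply: eq_bigr => t _; rewrite E scaler_sumr.
by apply: eq_bigr => u _; rewrite !scalerA mulrC.
Qed.

Fact delta_subproof (t : T) : (fun s => (s == t)%:R : K^o) \in finsupp (T := T).
Proof.
apply/asboolP; apply: sub_finite_set (finite_set1 t) => s /=.
by have [//|_] := eqVneq s t; rewrite eqxx.
Qed.
Definition delta (t : T) : F0 K T := MkF0 (delta_subproof t).

Lemma lincomb_delta V t (F : T -> V) : lincomb (delta t) F = F t.
Proof.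
rewrite (@lincombE [set t])// => [|s /=]; last by have [//|_] := eqVneq s t; rewrite eqxx.
by rewrite fset_set1 big_seq_fset1 /= eqxx scale1r.
Qed.

Lemma deltaE x : x = lincomb x delta.
Proof.
apply: F0P => t; rewrite (lincombE _ (F0_finite x))// F0_sumE /=.
have [xt|xt] := eqVneq (x t) 0.
  rewrite xt big1// => u _; case: eqVneq => [<-|]; rewrite ?mulr0//.
  by rewrite xt mul0r.
rewrite (bigD1_seq t)//=; last by rewrite in_fset_set ?inE//; exact: F0_finite.
rewrite eqxx mulr1 big1 ?addr0// => u /negPf ut.
by rewrite eq_sym ut mulr0.
Qed.

Lemma lincomb_bilinear V (F : T -> T -> V) :
  bilinear_for *:%R *:%R (fun x y => lincomb x (fun s => lincomb y (F s))).
Proof.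
split=> [y a x x'|x a y y']; first exact: lincombPl.
rewrite -lincombPr; congr lincomb; apply/funext => s; exact: lincombPl.
Qed.

End LinearCombination.

Section Heisenberg.
Variables (R : realType) (I : choiceType).
Local Notation C := R[i].

(* Labels of the basis of the Heisenberg algebra: inl (inl i) for p_i,
   inl (inr i) for q_i and inr tt for k. *)
Definition heis_index : Type := (I + I + unit)%type.
HB.instance Definition _ := Choice.on heis_index.

Definition heis_space := F0 C heis_index.
HB.instance Definition _ := GRing.Lmodule.on heis_space.

Definition heis_bracket0 (s t : heis_index) : heis_space :=
  match s, t with
  | inl (inl i), inl (inr j) => (i == j)%:R *: delta C (inr tt : heis_index)
  | inl (inr j), inl (inl i) => - ((i == j)%:R *: delta C (inr tt : heis_index))
  | _, _ => 0
  end.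

(* The bilinear extension of heis_bracket0. *)
Definition heis_bracket (x y : heis_space) : heis_space :=
  lincomb x (fun s => lincomb y (heis_bracket0 s)).

HB.instance Definition _ := bilinear_isBilinear.Build C
  heis_space heis_space heis_space *:%R *:%R heis_bracket
  (lincomb_bilinear heis_bracket0).

Lemma heis_bracket_alternating x : heis_bracket x x = 0.
Proof.
have anti s t : heis_bracket0 s t = - heis_bracket0 t s.
  by case: s => [[i|i]|[]]; case: t => [[j|j]|[]] //=; rewrite ?oppr0 ?opprK.
have H : heis_bracket x x = - heis_bracket x x.
  rewrite {1}/heis_bracket lincomb_exchange -scaleN1r -[RHS]addr0.
  rewrite /heis_bracket.
  have [s E] := lincombP heis_space x; rewrite !E addr0 scaler_sumr.
  apply: eq_bigr => t _; rewrite !E !scaler_sumr; apply: eq_bigr => u _.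
  by rewrite (anti u t) !scalerN scaleN1r.
rewrite -[LHS]scale1r -(@mulVf C 2) ?pnatr_eq0// -scalerA scaler_nat.
by rewrite [heis_bracket x x *+ 2]mulr2n {2}H subrr scaler0.
Qed.

Lemma heis_bracket_center x y z : heis_bracket x (heis_bracket y z) = 0.
Proof.
have lin w : linear (heis_bracket w).
  by move=> a u v; rewrite linearPr.
have xk : heis_bracket x (delta C (inr tt : heis_index)) = 0.
  apply: lincomb0 => s; rewrite lincomb_delta.
  by case: s => [[]|].
have [f fE] := linear_bundle (lin x); rewrite fE in xk *.
rewrite /heis_bracket (lincomb_linear _ _ (linearP f)); apply: lincomb0 => s.
rewrite -[LHS]/(f (lincomb z (heis_bracket0 s))).
rewrite (lincomb_linear _ _ (linearP f)); apply: lincomb0 => t /=.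
by case: s => [[i|i]|[]]; case: t => [[j|j]|[]];
  rewrite /= ?linear0// ?linearN linearZ /= xk scaler0 ?oppr0.
Qed.

Lemma heis_jacobi x y z :
  heis_bracket x (heis_bracket y z) + heis_bracket y (heis_bracket z x)
    + heis_bracket z (heis_bracket x y) = 0.
Proof. by rewrite !heis_bracket_center !addr0. Qed.

Definition heis : lieAlgebra C :=
  @LieAlgebra C heis_space heis_bracket heis_bracket_alternating heis_jacobi.

Definition heis_p (i : I) : heis := delta C (inl (inl i) : heis_index).
Definition heis_q (i : I) : heis := delta C (inl (inr i) : heis_index).
Definition heis_k : heis := delta C (inr tt : heis_index).

Lemma heis_pqE i j :
  lie_bracket heis (heis_p i) (heis_q j) = (i == j)%:R *: heis_k.
Proof. by rewrite /= /heis_bracket !lincomb_delta. Qed.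

Lemma heis_ppE i j : lie_bracket heis (heis_p i) (heis_p j) = 0.
Proof. by rewrite /= /heis_bracket !lincomb_delta. Qed.

Lemma heis_qqE i j : lie_bracket heis (heis_q i) (heis_q j) = 0.
Proof. by rewrite /= /heis_bracket !lincomb_delta. Qed.

Lemma heis_kE x : lie_bracket heis heis_k x = 0.
Proof.
have [s ] := lincombP heis_space x.
rewrite /= /heis_bracket lincomb_delta => ->.
by rewrite big1// => t _; rewrite /= scaler0.
Qed.

Lemma heis_basis (x : heis) : x = lincomb x (fun t => delta C t).
Proof. exact: deltaE. Qed.

End Heisenberg.

(* The level 1 module defined by operators P i, Q i with
   [P i, P j] = [Q i, Q j] = 0 and [P i, Q j] = delta_ij. *)
Section HeisenbergModule.
Variables (R : realType) (I : choiceType).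
Local Notation C := R[i].
Variables (V : lmodType C) (P Q : I -> V -> V).
Hypothesis P_linear : forall i, linear (P i).
Hypothesis Q_linear : forall i, linear (Q i).
Hypothesis PP : forall i j v, P i (P j v) = P j (P i v).
Hypothesis QQ : forall i j v, Q i (Q j v) = Q j (Q i v).
Hypothesis PQ : forall i j v, P i (Q j v) = Q j (P i v) + (i == j)%:R *: v.

Definition heis_act0 (v : V) (s : heis_index I) : V :=
  match s with
  | inl (inl i) => P i v
  | inl (inr i) => Q i v
  | inr tt => v
  end.

Definition heis_act (x : heis R I) (v : V) : V := lincomb x (heis_act0 v).

Let heis_act0_linear s : linear (heis_act0^~ s).
Proof. by case: s => [[]|[]]. Qed.

Let heis_act_bilinear : bilinear_for *:%R *:%R heis_act.
Proof.
split=> [v a x y|x a u v]; first exact: lincombPl.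
by rewrite -lincombPr; congr lincomb; apply/funext => s; exact: heis_act0_linear.
Qed.

HB.instance Definition _ := bilinear_isBilinear.Build C
  (heis R I) V V *:%R *:%R heis_act heis_act_bilinear.

Let heis_actB x y v :
  heis_act (lie_bracket (heis R I) x y) v
    = heis_act x (heis_act y v) - heis_act y (heis_act x v).
Proof.
have [f fE] := linear_bundle (heis_act_bilinear.1 v).
have fl := linearP f.
have actact z w : heis_act z (heis_act w v) =
    lincomb z (fun s => lincomb w (fun t => heis_act0 (heis_act0 v t) s)).
  congr lincomb; apply/funext => s.
  exact: (lincomb_linear _ _ (@heis_act0_linear s)).
rewrite !actact [X in _ - X]lincomb_exchange.
rewrite addrC -scaleN1r -lincombPr -[LHS]/((heis_act^~ v) _) fE.
rewrite lincomb_linear//.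
congr lincomb; apply/funext => s.
rewrite -lincombPr /= lincomb_linear//.
congr lincomb; apply/funext => t; rewrite scaleN1r addrC /=.
have fk : f (heis_k R I) = v.
  by rewrite -[LHS]/((f : _ -> _) _) -fE /heis_act lincomb_delta.
case: s => [[i|i]|[]]; case: t => [[j|j]|[]]; rewrite /= ?linear0 ?subrr//.
- by rewrite PP subrr.
- by rewrite linearZ_LR fk PQ addrC addKr.
- by rewrite linearN linearZ_LR fk PQ opprD addrA subrr add0r eq_sym.
- by rewrite QQ subrr.
Qed.

Definition heis_module : lieModule (heis R I) :=
  @LieModule C (heis R I) V heis_act heis_actB.

End HeisenbergModule.
Section PartialDerivatives.
Variables (K : numFieldType) (I : choiceType).
Implicit Types (x : I -> K) (f g : (I -> K) -> K).

(* The algebra generated by the coordinate functions x_i, i in I. As K is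
   infinite, polynomials and polynomial functions are the same thing. *)
Inductive polynomial_function : ((I -> K) -> K) -> Prop :=
| polynomial_const c : polynomial_function (fun=> c)
| polynomial_var i : polynomial_function (fun x => x i)
| polynomial_add f g : polynomial_function f -> polynomial_function g ->
    polynomial_function (fun x => f x + g x)
| polynomial_mul f g : polynomial_function f -> polynomial_function g ->
    polynomial_function (fun x => f x * g x).

(* d f / d x_i. As [derive1] is a total function, this is meaningful only where
   f is derivable in the variable x_i (see [is_partial]). *)
Definition partial (i : I) f : (I -> K) -> K :=
  fun x => derive1 (fun t : K => f [eta x with i |-> t]) (x i).

Definition is_partial (i : I) f f' : Prop :=
  forall x, is_derive (x i) 1 (fun t : K => f [eta x with i |-> t]) (f' x).

Lemma eta_with_id x i : [eta x with i |-> x i] = x :> (I -> K).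
Proof. by apply/funext => j /=; case: eqVneq => [->|]. Qed.

Lemma is_partialE i f f' : is_partial i f f' -> partial i f = f'.
Proof.
move=> ff'; apply/funext => x; rewrite /partial derive1E.
exact: (@derive_val _ _ _ _ _ _ _ (ff' x)).
Qed.

Lemma is_partial_cst i c : is_partial i (fun=> c) (fun=> 0).
Proof. move=> x; exact: is_derive_cst. Qed.

Lemma is_partial_var i j : is_partial i (fun x => x j) (fun=> (i == j)%:R).
Proof.
move=> x /=; rewrite [X in is_derive _ _ X _](_ : _ =
  if j == i then id else cst (x j)); last by case: ifP.
by rewrite eq_sym; case: ifP => _; [exact: is_derive_id|exact: is_derive_cst].
Qed.

Lemma is_partialD i f g f' g' : is_partial i f f' -> is_partial i g g' ->
  is_partial i (fun x => f x + g x) (fun x => f' x + g' x).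
Proof. by move=> ff gg x; apply: is_deriveD. Qed.

Lemma is_partialM i f g f' g' : is_partial i f f' -> is_partial i g g' ->
  is_partial i (fun x => f x * g x) (fun x => f' x * g x + f x * g' x).
Proof.
move=> ff gg x; have := is_deriveM (ff x) (gg x).
rewrite !eta_with_id => H; apply: is_derive_eq H _.
by rewrite addrC; congr (_ + _); rewrite -[LHS]/(_ * _) mulrC.
Qed.

Lemma polynomial_partial i f : polynomial_function f ->
  is_partial i f (partial i f) /\ polynomial_function (partial i f).
Proof.
have ind f0 f' : is_partial i f0 f' -> polynomial_function f' ->
    is_partial i f0 (partial i f0) /\ polynomial_function (partial i f0).
  by move=> /[dup] /is_partialE ->.
elim=> [c|j|{}f g pf [ff ff'] pg [gg gg']|{}f g pf [ff ff'] pg [gg gg']].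
- exact: ind (@is_partial_cst i c) (polynomial_const 0).
- exact: ind (@is_partial_var i j) (polynomial_const _).
- exact: ind (is_partialD ff gg) (polynomial_add ff' gg').
- apply: ind (is_partialM ff gg) _.
  by apply: polynomial_add; apply: polynomial_mul.
Qed.

Lemma polynomial_partialC i j f : polynomial_function f ->
  partial i (partial j f) = partial j (partial i f).
Proof.
elim=> [c|k|{}f g pf fC pg gC|{}f g pf fC pg gC].
- by rewrite !(is_partialE (is_partial_cst _ _)).
- by rewrite !(is_partialE (is_partial_var _ _), is_partialE (is_partial_cst _ _)).
- rewrite !(is_partialE (is_partialD
    (polynomial_partial _ pf).1 (polynomial_partial _ pg).1)).
  have [_ pjf] := polynomial_partial j pf.
  have [_ pjg] := polynomial_partial j pg.
  have [_ pif] := polynomial_partial i pf.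
  have [_ pig] := polynomial_partial i pg.
  rewrite (is_partialE (is_partialD
    (polynomial_partial i pjf).1 (polynomial_partial i pjg).1)).
  rewrite (is_partialE (is_partialD
    (polynomial_partial j pif).1 (polynomial_partial j pig).1)).
  by rewrite fC gC.
- rewrite !(is_partialE (is_partialM
    (polynomial_partial _ pf).1 (polynomial_partial _ pg).1)).
  have [if_ pif] := polynomial_partial i pf.
  have [ig_ pig] := polynomial_partial i pg.
  have [jf_ pjf] := polynomial_partial j pf.
  have [jg_ pjg] := polynomial_partial j pg.
  rewrite (is_partialE (is_partialD
    (is_partialM (polynomial_partial i pjf).1 ig_)
    (is_partialM if_ (polynomial_partial i pjg).1))).
  rewrite (is_partialE (is_partialD
    (is_partialM (polynomial_partial j pif).1 jg_)
    (is_partialM jf_ (polynomial_partial j pig).1))).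
  rewrite fC gC; apply/funext => x.
  by rewrite !addrA; congr (_ + _); rewrite -!addrA; congr (_ + _); rewrite addrC.
Qed.

Section ExponentialTimesPolynomial.
Variables (E : (I -> K) -> K) (lam : I -> K).
Hypothesis E_partial : forall i, is_partial i E (fun x => lam i * E x).

(* The space of functions E K[x_i | i in I]. *)
Definition exp_polynomial : set ((I -> K) -> K) :=
  [set f | exists2 P, polynomial_function P & f = (fun x => E x * P x)].

Lemma exp_polynomial_is_partial i P : polynomial_function P ->
  is_partial i (fun x => E x * P x)
    (fun x => E x * (lam i * P x + partial i P x)).
Proof.
move=> /(polynomial_partial i)[iP _] x.
apply: is_derive_eq (is_partialM (E_partial i) iP x) _.
by rewrite mulrDr mulrCA mulrA.
Qed.

Lemma exp_polynomial_partial_is i f : exp_polynomial f ->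
  is_partial i f (partial i f).
Proof.
move=> [P pP ->].
by rewrite (is_partialE (exp_polynomial_is_partial _ _))//;
  exact: exp_polynomial_is_partial.
Qed.

Let twist_poly i P : polynomial_function P ->
  polynomial_function (fun x => lam i * P x + partial i P x).
Proof.
move=> pP; apply: polynomial_add; last exact: (polynomial_partial i pP).2.
by apply: polynomial_mul => //; exact: polynomial_const.
Qed.

Lemma exp_polynomial_partial i f : exp_polynomial f ->
  exp_polynomial (partial i f).
Proof.
move=> [P pP ->]; rewrite (is_partialE (exp_polynomial_is_partial _ _))//.
by eexists; first exact: (twist_poly i pP).
Qed.

Lemma exp_polynomial_var i f : exp_polynomial f ->
  exp_polynomial (fun x => x i * f x).
Proof.
move=> [P pP ->]; exists (fun x => x i * P x).
  by apply: polynomial_mul => //; exact: polynomial_var.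
by apply/funext => x; rewrite mulrCA.
Qed.

Lemma exp_polynomial_lin a f g : exp_polynomial f -> exp_polynomial g ->
  exp_polynomial (fun x => a * f x + g x).
Proof.
move=> [P pP ->] [Q pQ ->]; exists (fun x => a * P x + Q x).
  apply: polynomial_add => //.
  by apply: polynomial_mul => //; exact: polynomial_const.
by apply/funext => x; rewrite mulrDr mulrCA.
Qed.

Lemma exp_polynomial0 : exp_polynomial (fun=> 0).
Proof.
by exists (fun=> 0); [exact: polynomial_const|apply/funext => x; rewrite mulr0].
Qed.

Lemma partial_linear i a f g : exp_polynomial f -> exp_polynomial g ->
  partial i (fun x => a * f x + g x)
    = (fun x => a * partial i f x + partial i g x).
Proof.
move=> /(exp_polynomial_partial_is i) ff /(exp_polynomial_partial_is i) gg.
rewrite (is_partialE (is_partialD (is_partialM (is_partial_cst _ a) ff) gg)).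
by apply/funext => x; rewrite mul0r add0r.
Qed.

Lemma exp_partialC i j f : exp_polynomial f ->
  partial i (partial j f) = partial j (partial i f).
Proof.
move=> [P pP ->]; rewrite !(is_partialE (exp_polynomial_is_partial _ pP)).
rewrite !(is_partialE (exp_polynomial_is_partial _ (twist_poly _ pP))).
apply/funext => x; apply: (congr1 ( *%R (E x))).
have H k l : partial k (fun x => lam l * P x + partial l P x) =
   fun x => lam l * partial k P x + partial k (partial l P) x.
  rewrite (is_partialE (is_partialD
    (is_partialM (is_partial_cst _ _) (polynomial_partial _ pP).1)
    (polynomial_partial _ (polynomial_partial _ pP).2).1)).
  by apply/funext => y; rewrite mul0r add0r.
rewrite !H (polynomial_partialC _ _ pP) !mulrDr !addrA; congr (_ + _).
by rewrite mulrCA -!addrA; congr (_ + _); rewrite addrC.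
Qed.

Lemma exp_partial_var i j f : exp_polynomial f ->
  partial i (fun x => x j * f x)
    = (fun x => x j * partial i f x + (i == j)%:R * f x).
Proof.
move=> /(exp_polynomial_partial_is i) ff.
rewrite (is_partialE (is_partialM (is_partial_var i j) ff)).
by apply/funext => x; rewrite addrC.
Qed.

End ExponentialTimesPolynomial.
End PartialDerivatives.
Section ComplexExponential.
Variable R : realType.
Local Notation C := R[i].
Local Open Scope complex_scope.

(* exp (a + i b) = exp a (cos b + i sin b). *)
Definition cexp (z : C) : C :=
  (expR (complex.Re z) * cos (complex.Im z))
    +i* (expR (complex.Re z) * sin (complex.Im z)).

Lemma cexpD z w : cexp (z + w) = cexp z * cexp w.
Proof.
case: z w => [a b] [c d]; rewrite /cexp /= expRD cosD sinD.
by apply/eqP; rewrite eq_complex /=; apply/andP; split; apply/eqP; ring.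
Qed.

Let derive_bound (f : R -> R) (df : R) : is_derive (0 : R) (1 : R) f df ->
  forall e : R, 0 < e ->
    exists2 d, 0 < d & forall a, `|a| < d -> `|f a - f 0 - a * df| <= e * `|a|.
Proof.
move=> [/derivable_nbhsP + <-] e e0.
move=> /eqaddoP/(_ e e0) /nbhs_ballP[d /= d0 H].
exists d => // a ad; have := H a; rewrite -ball_normE /= sub0r normrN => /(_ ad).
by rewrite /= !fctE /= addr0 scaler1 opprD addrA.
Qed.

Lemma cexp_bound (e : R) : 0 < e -> exists2 d : R, 0 < d &
  forall z : C, `|z| < d%:C -> `|cexp z - 1 - z| <= e%:C * `|z|.
Proof.
move=> e0.
have [m [m0 m1 me]] : exists m : R, [/\ 0 < m, m <= 1 & 8 * m <= e].
  exists (Num.min (e / 8) 1); split; first by rewrite lt_min ltr01 divr_gt0.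
    by rewrite ge_min lexx orbT.
  by rewrite mulrC -ler_pdivlMr// ge_min lexx.
have [d1 d10 H1] := derive_bound (is_derive_expR 0) m0.
have [d2 d20 H2] := derive_bound (is_derive_cos 0) m0.
have [d3 d30 H3] := derive_bound (is_derive_sin 0) m0.
exists (Num.min m (Num.min d1 (Num.min d2 d3))).
  by rewrite !lt_min m0 d10 d20 d30.
move=> z; set d := Num.min _ _ => zd.
rewrite [X in _ <= _ * X]normc_def; rewrite normc_def in zd.
case: z zd => a b; set r := Num.sqrt _; rewrite /= ltcR => rd.
have az : `|a| <= r.
  by rewrite -sqrtr_sqr ler_wsqrtr// lerDl sqr_ge0.
have bz : `|b| <= r.
  by rewrite -sqrtr_sqr ler_wsqrtr// lerDr sqr_ge0.
have ad : `|a| < d by exact: le_lt_trans rd.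
have bd : `|b| < d by exact: le_lt_trans rd.
move: ad bd; rewrite !lt_min => /and4P[am ad1 ad2 ad3] /and4P[bm bd1 bd2 bd3].
have {H1} := H1 a ad1; have {H2} := H2 b bd2; have {H3} := H3 b bd3.
rewrite expR0 cos0 sin0 !mulr1 oppr0 !mulr0 !subr0 addr0.
set A := expR a; set c := cos b; set s := sin b => Hs Hc HA.
have cle : `|c| <= 1 by rewrite cos_max.
have -> : cexp (a +i* b) - 1 - (a +i* b) =
   ((A - 1 - a) * c + (1 + a) * (c - 1)) +i* ((A - 1 - a) * s + a * s + (s - b)).
  apply/eqP; rewrite eq_complex /= -/A -/c -/s.
  by apply/andP; split; apply/eqP; ring.
set u := _ + _; set v := _ + _.
have ub : `|u| <= 3 * m * r.
  apply: le_trans (ler_normD _ _) _; rewrite !normrM.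
  have h1 : `|1 + a| <= 2.
    by apply: le_trans (ler_normD _ _) _; rewrite normr1 -[2]/(1 + 1) lerD2l;
      exact: le_trans (ltW am) m1.
  have p1 : `|A - 1 - a| * `|c| <= m * r.
    rewrite -[m * r]mulr1 ler_pM//; apply: le_trans HA _.
    by rewrite ler_pM2l.
  have p2 : `|1 + a| * `|c - 1| <= 2 * (m * r).
    by rewrite ler_pM//; apply: le_trans Hc _; rewrite ler_pM2l.
  by rewrite -mulrA; lra.
have vb : `|v| <= 5 * m * r.
  have p1 : `|s| <= 2 * r.
    rewrite -[s](subrK b); apply: le_trans (ler_normD _ _) _.
    have : m * `|b| <= 1 * r by rewrite ler_pM// ltW.
    by rewrite mul1r => ?; lra.
  have p2 : `|A - 1 - a| <= m.
    apply: le_trans HA _; rewrite -[leRHS]mulr1 ler_pM2l//.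
    exact: le_trans (ltW am) m1.
  have p3 : `|A - 1 - a| * `|s| <= m * (2 * r) by rewrite ler_pM.
  have p4 : `|a| * `|s| <= m * (2 * r) by rewrite ler_pM// ltW.
  have p5 : `|s - b| <= m * r by apply: le_trans Hs _; rewrite ler_pM2l.
  rewrite /v; apply: le_trans (ler_normD _ _) _.
  have := ler_normD ((A - 1 - a) * s) (a * s); rewrite !normrM => ?.
  by rewrite -mulrA; lra.
rewrite normc_def -rmorphM /= lecR.
apply: (@le_trans _ _ (`|u| + `|v|)); last first.
  have : 8 * m * r <= e * r by apply: ler_wpM2r; rewrite ?sqrtr_ge0.
  by move=> ?; lra.
rewrite -[leRHS]ger0_norm ?addr_ge0// -sqrtr_sqr /=.
rewrite ler_wsqrtr// -[X in X + _]real_normK ?num_real//.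
rewrite -[X in _ + X]real_normK ?num_real// sqrrD addrAC lerDl.
by rewrite mulrn_wge0// mulr_ge0.
Qed.

Lemma cexp0 : cexp 0 = 1.
Proof. by rewrite /cexp /= expR0 cos0 sin0 mulr1 mulr0. Qed.

Lemma is_derive_cexp (c l t : C) :
  is_derive (t : C^o) 1 (fun t : C^o => cexp (c + t * l) : C^o)
    (l * cexp (c + t * l)).
Proof.
set w := c + t * l; pose M := (`|cexp w| + 1) * (`|l| + 1).
have M0 : 0 < M by rewrite mulr_gt0// ltr_wpDl.
have cv : (fun h : C^o => h^-1 *: (cexp (c + (h *: 1 + t) * l) - cexp w : C^o))
    @ 0^' --> (l * cexp w : C^o).
  apply/cvgrPdist_le => /= eps eps0.
  have [e e0 eE] : exists2 e : R, 0 < e & e%:C * M <= eps.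
    have : 0 < eps / M by rewrite divr_gt0.
    case E : (eps / M) => [e f] /=; rewrite ltcE /= => /andP[/eqP f0 e0].
    by exists e => //; rewrite -ler_pdivlMr// E f0.
  have [d d0 H] := cexp_bound e0.
  have dl : 0 < d%:C / (`|l| + 1) by rewrite divr_gt0 ?ltr_wpDl// ltcR.
  near=> h.
  have h0 : h != 0 by near: h; exact: nbhs_dnbhs_neq.
  have hd : `|h * l| < d%:C.
    have : `|h| < d%:C / (`|l| + 1).
      by near: h; apply: dnbhs0_lt.
    rewrite ltr_pdivlMr ?ltr_wpDl// normrM; apply: le_lt_trans.
    by rewrite ler_wpM2l// lerDl.
  have -> : c + (h *: 1 + t) * l = w + h * l.
    by rewrite /w -[h *: 1]/(h * 1); ring.
  rewrite cexpD.
  have -> : l * cexp w - h^-1 *: (cexp w * cexp (h * l) - cexp w) =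
      - (cexp w * h^-1 * (cexp (h * l) - 1 - h * l)).
    by rewrite -[_ *: _]/(_ * _); field.
  rewrite normrN !normrM.
  have {}H := H _ hd.
  apply: (@le_trans _ _ (`|cexp w| * `|h^-1| * (e%:C * `|h * l|))).
    by rewrite ler_wpM2l// mulr_ge0.
  rewrite normrM normfV.
  have aux (x y z u : C) : y != 0 -> x / y * (z * (y * u)) = z * (x * u).
    by move=> y0; field.
  rewrite aux ?normr_eq0//.
  apply: le_trans eE; rewrite ler_wpM2l ?ler0c ?(ltW e0)//.
  by rewrite /M ler_pM// lerDl.
by split; [apply/cvg_ex; eexists; exact: cv|exact: cvg_lim cv].
Unshelve. all: by end_near.
Qed.

End ComplexExponential.
Section ExponentialModule.
Variables (R : realType) (I : choiceType) (lam : F0 R[i] I).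
Local Notation C := R[i].

(* The function x |-> e^(lambda x). *)
Definition exp_lambda (x : I -> C) : C :=
  cexp (\sum_(i \in [set: I]) lam i * x i).

Lemma exp_lambda_partial i :
  is_partial i exp_lambda (fun x => lam i * exp_lambda x).
Proof.
have single : lincomb lam (fun j => (i == j)%:R : C^o) = lam i.
  rewrite {2}(deltaE lam) !(lincombE _ (F0_finite lam))// F0_sumE.
  exact: eq_bigr.
move=> x; set c := lincomb lam [eta x with i |-> 0 : C^o].
have sumE t : \sum_(j \in [set: I]) lam j * [eta x with i |-> t] j = c + t * lam i.
  rewrite addrC -single -[t * _]/(t *: _) -lincombPr.
  apply: eq_fsbigr => j _ /=; rewrite -[RHS]/(_ * _); congr (_ * _).
  rewrite -[t *: _]/(t * _) eq_sym.
  by case: eqVneq => _; rewrite ?mulr1 ?mulr0 ?addr0 ?add0r.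
have E t : exp_lambda [eta x with i |-> t] = cexp (c + t * lam i).
  by rewrite /exp_lambda sumE.
rewrite -[in X in is_derive _ _ _ X](eta_with_id x i) E.
rewrite (_ : (fun t => _) = (fun t : C^o => cexp (c + t * lam i) : C^o)).
  exact: is_derive_cexp.
by apply/funext => t; exact: E.
Qed.

Definition M1_pred : {pred (I -> C) -> C^o} :=
  fun f => `[< exp_polynomial exp_lambda f >].

(* M(1, lambda) = e^(lambda x) C[x_i | i in I], as a space of functions of
   x : I -> C. *)
Record M1_space := MkM1 {
  M1_val :> (I -> C) -> C^o;
  M1_valP : M1_val \in M1_pred }.

HB.instance Definition _ := [isSub for M1_val].
HB.instance Definition _ := [Choice of M1_space by <:].

Lemma M1_submod : submod_closed M1_pred.
Proof.
split; first by apply/asboolP; exact: exp_polynomial0.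
by move=> a f g /asboolP ff /asboolP gg; apply/asboolP; exact: exp_polynomial_lin.
Qed.
HB.instance Definition _ :=
  GRing.isSubmodClosed.Build C ((I -> C) -> C^o) M1_pred M1_submod.
HB.instance Definition _ := [SubChoice_isSubLmodule of M1_space by <:].

Let M1P (f : M1_space) : exp_polynomial exp_lambda f.
Proof. exact/asboolP/(M1_valP f). Qed.

Fact M1_p_subproof i (f : M1_space) : (partial i f : _ -> C^o) \in M1_pred.
Proof. exact/asboolP/(exp_polynomial_partial exp_lambda_partial). Qed.
Definition M1_p i (f : M1_space) : M1_space := MkM1 (M1_p_subproof i f).

Fact M1_q_subproof i (f : M1_space) : (fun x => x i * f x : C^o) \in M1_pred.
Proof. exact/asboolP/exp_polynomial_var. Qed.
Definition M1_q i (f : M1_space) : M1_space := MkM1 (M1_q_subproof i f).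

Let M1_p_linear i : linear (M1_p i).
Proof.
move=> a f g; apply: val_inj.
exact: (partial_linear exp_lambda_partial i a (M1P f) (M1P g)).
Qed.

Let M1_q_linear i : linear (M1_q i).
Proof.
move=> a f g; apply/val_inj/funext => x.
rewrite -[LHS]/(x i * (a * f x + g x)) -[RHS]/(a * (x i * f x) + x i * g x).
by rewrite mulrDr mulrCA.
Qed.

Let M1_pp i j f : M1_p i (M1_p j f) = M1_p j (M1_p i f).
Proof. by apply: val_inj; exact: (exp_partialC exp_lambda_partial i j (M1P f)). Qed.

Let M1_qq i j f : M1_q i (M1_q j f) = M1_q j (M1_q i f).
Proof. by apply/val_inj/funext => x /=; rewrite mulrCA. Qed.

Let M1_pq i j f : M1_p i (M1_q j f) = M1_q j (M1_p i f) + (i == j)%:R *: f.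
Proof. by apply: val_inj; exact: (exp_partial_var exp_lambda_partial i j (M1P f)). Qed.

Definition M1 : lieModule (heis R I) :=
  heis_module M1_p_linear M1_q_linear M1_pp M1_qq M1_pq.

Lemma M1_pE i (f : M1) : lie_act (heis_p R i) f = M1_p i f.
Proof. by rewrite /= /heis_act lincomb_delta. Qed.

Lemma M1_qE i (f : M1) : lie_act (heis_q R i) f = M1_q i f.
Proof. by rewrite /= /heis_act lincomb_delta. Qed.

Lemma M1_kE (f : M1) : lie_act (heis_k R I) f = f.
Proof. by rewrite /= /heis_act lincomb_delta. Qed.

End ExponentialModule.

Section CategoryF.
Variables (R : realType) (I : choiceType) (W : lieModule (heis R I)).

Definition heis_level (l : R[i]) : Prop :=
  forall w : W, lie_act (heis_k R I) w = l *: w.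

Definition heis_restricted : Prop :=
  forall w : W, finite_set [set i : I | lie_act (heis_p R i) w != 0].

Definition category_F : Prop :=
  [/\ heis_restricted, heis_level 1 &
      forall i : I, locally_finite (fun w : W => lie_act (heis_p R i) w)].

End CategoryF.

(* Main.v *)
(* The span N of the q-monomials on joint eigenvectors of the p_i is all of an
   object W of F: the operator p_i - a maps the span of the q_i^n u, with u an
   eigenvector of p_i, onto itself, so a vector annihilated by a split
   polynomial in p_i belongs to that span, and one treats one by one the
   finitely many i with p_i w <> 0.
   If v is a joint eigenvector with eigenvalues mu, the operators p_i - mu_i
   lower the degree of the q-monomials on v, and by the Euler operator
   \sum_i q_i (p_i - mu_i) they have no common kernel in positive degree. Hence
   every nonzero submodule of the module generated by v contains v, and that
   module is irreducible. So W is a sum of irreducible submodules, hence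
   semisimple. Two modules generated by joint eigenvectors v and w with the same
   eigenvalues are isomorphic, as the submodule generated by (v, w) in the
   product is the graph of an isomorphism; M(1, lambda) is generated by
   e^(lambda x). *)
From HB Require Import structures.
Require Import Defs.
From mathcomp Require Import all_boot all_order all_algebra.
From mathcomp Require Import finmap complex.
From mathcomp Require Import all_classical all_reals all_analysis.
Import Order.TTheory GRing.Theory Num.Theory.

Set Implicit Arguments.
Unset Strict Implicit.
Unset Printing Implicit Defensive.

Local Open Scope classical_set_scope.
Local Open Scope ring_scope.

(** * Linear spans *)

Section Span.
Variables (K : fieldType) (V : lmodType K).
Implicit Types (N G : set V).

Definition subspace N : Prop :=
  N 0 /\ forall a x y, N x -> N y -> N (a *: x + y).

Lemma subspaceD N x y : subspace N -> N x -> N y -> N (x + y).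
Proof. by move=> [_ NL] Nx Ny; rewrite -[x]scale1r; exact: NL. Qed.

Lemma subspaceZ N a x : subspace N -> N x -> N (a *: x).
Proof. by move=> [N0 NL] Nx; rewrite -[_ *: _]addr0; exact: NL. Qed.

Lemma subspaceB N x y : subspace N -> N x -> N y -> N (x - y).
Proof. by move=> [_ NL] Nx Ny; rewrite addrC -scaleN1r; exact: NL. Qed.

Lemma subspace_sum N (J : eqType) (s : seq J) (F : J -> V) : subspace N ->
  (forall j, j \in s -> N (F j)) -> N (\sum_(j <- s) F j).
Proof.
move=> sN NF; rewrite big_seq; elim/big_ind: _ => //; first by case: sN.
by move=> x y; exact: subspaceD.
Qed.

Lemma subspaceI N G : subspace N -> subspace G -> subspace (N `&` G).
Proof.
by move=> [N0 NL] [G0 GL]; split=> // a x y [Nx Gx] [Ny Gy]; split; auto.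
Qed.

Definition span G : set V := smallest subspace G.

Lemma span_min G N : subspace N -> G `<=` N -> span G `<=` N.
Proof. exact: smallest_sub. Qed.

Lemma sub_span G : G `<=` span G.
Proof. exact: sub_smallest. Qed.

Lemma span_subspace G : subspace (span G).
Proof.
split=> [N [[N0 _] _] //|a x y Gx Gy N [sN GN]].
by apply: sN.2; [apply: Gx|apply: Gy].
Qed.

Lemma span0 G : span G 0.
Proof. by case: (span_subspace G). Qed.

Lemma span_sub G H : G `<=` H -> span G `<=` span H.
Proof.
move=> GH; apply: span_min (span_subspace _) _ => x /GH; exact: sub_span.
Qed.

Lemma span_setU G N x : subspace N -> span (G `|` N) x ->
  exists y z, [/\ span G y, N z & x = y + z].
Proof.
move=> sN; have [N0 NL] := sN; have [G0 GL] := span_subspace G.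
apply: (@span_min _ [set x | exists y z, [/\ span G y, N z & x = y + z]]).
  split; first by exists 0, 0; rewrite addr0.
  move=> a _ _ [y [z [Gy Nz ->]]] [y' [z' [Gy' Nz' ->]]].
  exists (a *: y + y'), (a *: z + z'); split; [exact: GL|exact: NL|].
  by rewrite scalerDr addrACA.
move=> {}x [Gx|Nx]; first by exists x, 0; split=> //; rewrite ?addr0//; exact: sub_span.
by exists 0, x; rewrite add0r.
Qed.

Lemma span_set1 x y : span [set x] y -> exists c, y = c *: x.
Proof.
apply: (@span_min _ [set y | exists c, y = c *: x]).
  split; first by exists 0; rewrite scale0r.
  by move=> a _ _ [c ->] [d ->]; exists (a * c + d); rewrite scalerDl scalerA.
by move=> _ ->; exists 1; rewrite scale1r.
Qed.

End Span.

Lemma linear_preimage_subspace (K : fieldType) (V W : lmodType K) (f : {linear W -> V})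
    (N : set V) :
  subspace N -> subspace (f @^-1` N).
Proof.
by move=> [N0 NL]; split=> [|a x y Nx Ny]; rewrite /preimage/= ?linear0 ?linearP//; exact: NL.
Qed.

Lemma span_stable (K : fieldType) (V : lmodType K) (f : {linear V -> V})
    (G : set V) :
  (forall x, G x -> span G (f x)) -> forall x, span G x -> span G (f x).
Proof.
move=> Gf x; apply: (@span_min _ _ _ (f @^-1` span G)) => //.
exact: linear_preimage_subspace (span_subspace _).
Qed.

(** * Vacuum vectors *)

(* D i and Q i act like the derivation and the multiplication by the i-th
   variable, v is a vacuum vector. *)
Section Vacuum.
Variables (K : numFieldType) (V : lmodType K) (I : eqType).
Variables (D Q : I -> {linear V -> V}) (v : V).

Definition monomial (l : seq I) : V := foldr (fun i => Q i) v l.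

Lemma span_monomial_Q i x :
  span (range monomial) x -> span (range monomial) (Q i x).
Proof.
apply: span_stable => _ [l _ <-]; apply: sub_span; by exists (i :: l).
Qed.

Hypothesis DQ : forall i j w, D i (Q j w) = Q j (D i w) + (i == j)%:R *: w.
Hypothesis Dv : forall i, D i v = 0.

(** Degree filtration. The strict bound makes [F 0] zero and [F 1] the span of [v]. *)
Let F n : set V := span [set monomial l | l in [set l | (size l < n)%N]].

Let F_subspace n : subspace (F n).
Proof. exact: span_subspace. Qed.

Let F_sub m n : (m <= n)%N -> F m `<=` F n.
Proof.
by move=> mn; apply: span_sub => _ [l lm <-]; exists l => //; exact: leq_trans mn.
Qed.

Let Q_F i n x : F n x -> F n.+1 (Q i x).
Proof.
apply: (@span_min _ _ _ (Q i @^-1` F n.+1)).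
  exact: linear_preimage_subspace (span_subspace _).
by move=> _ [l ln <-]; apply: sub_span; exists (i :: l).
Qed.

(** Moving [D i] through a monomial leaves terms with one factor fewer, since [D i] kills [v] at the
    end. *)
Let D_F i n x : F n.+1 x -> F n (D i x).
Proof.
move: x; apply: (@span_min _ _ _ (D i @^-1` F n)).
  exact: linear_preimage_subspace (span_subspace _).
move=> _ [l ln <-] /=; elim: l n ln => [|j l IH] n /=.
  by rewrite Dv => _; exact: span0.
case: n => // n; rewrite 2!ltnS DQ => ln.
apply: (subspaceD (F_subspace n.+1)); first by apply: Q_F; exact: IH.
apply: (subspaceZ _ (F_subspace n.+1)).
by apply: sub_span; exists l.
Qed.

Let F_span x : span (range monomial) x -> exists n, F n x.
Proof.
apply: (@span_min _ _ _ [set x | exists n, F n x]).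
  split; first by exists 0%N; exact: span0.
  move=> a y z [m Fy] [n Fz]; exists (maxn m n).
  apply: (F_subspace _).2; first exact: F_sub (leq_maxl _ _) _ _.
  exact: F_sub (leq_maxr _ _) _ _.
by move=> _ [l _ <-]; exists (size l).+1; apply: sub_span; exists l => /=.
Qed.

Lemma span_monomial_D i x :
  span (range monomial) x -> span (range monomial) (D i x).
Proof.
move=> /F_span[n /(F_sub (leqnSn n))/(D_F i)]; apply: span_sub => _ [l _ <-].
by exists l.
Qed.

Hypothesis QQ : forall i j w, Q i (Q j w) = Q j (Q i w).

Let QD_monomial i l : Q i (D i (monomial l)) = (count_mem i l)%:R *: monomial l.
Proof.
elim: l => [|j l IH] /=; first by rewrite Dv linear0 scale0r.
rewrite DQ linearD linearZ /= QQ IH linearZ /= natrD addrC scalerDl eq_sym.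
by case: eqVneq => [->|]; rewrite ?scale0r.
Qed.

(* The Euler operator \sum_i Q i \o D i multiplies monomials by their degree. *)
Let euler n x : F n.+1 x -> (forall i, D i x = 0) -> F n (n%:R *: x).
Proof.
move=> Fx Dx.
(* [I] may be infinite, so the Euler sum runs over a finite list. Claiming the result for all larger
   lists lets it pass to linear combinations, whose terms need different lists. *)
suff [s0 H] : exists s0 : seq I, forall s : seq I, uniq s -> {subset s0 <= s} ->
    F n (n%:R *: x - \sum_(i <- s) Q i (D i x)).
  have := H (undup s0) (undup_uniq _); rewrite big1 ?subr0.
    by apply=> i; rewrite mem_undup.
  by move=> i _; rewrite Dx linear0.
move: x {Dx} Fx; apply: span_min.
  split.
    exists [::] => s _ _; rewrite scaler0 big1 ?subr0.
      by exact: span0.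
    by move=> i _; rewrite !linear0.
  move=> a x y [sx Hx] [sy Hy]; exists (sx ++ sy) => s us sub.
  have {}Hx : F n (n%:R *: x - \sum_(i <- s) Q i (D i x)).
    by apply: Hx => // i si; apply: sub; rewrite mem_cat si.
  have {}Hy : F n (n%:R *: y - \sum_(i <- s) Q i (D i y)).
    by apply: Hy => // i si; apply: sub; rewrite mem_cat si orbT.
  have := (F_subspace n).2 a _ _ Hx Hy; congr (F n _).
  rewrite scalerBr scalerDr !scalerA [a * _]mulrC addrACA -opprD.
  congr (_ - _); rewrite scaler_sumr -big_split; apply: eq_bigr => i _ /=.
  by rewrite !linearP.
move=> _ [l /= ln <-]; exists l => s us sub.
under eq_bigr do rewrite QD_monomial.
rewrite -scaler_suml -natr_sum.
have -> : (\sum_(i <- s) count_mem i l = size l)%N.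
  elim: l sub {ln} => [|j l IH] sub /=; first by rewrite big1.
  rewrite big_split /= IH => [|i il]; last by apply: sub; rewrite inE il orbT.
  rewrite (bigD1_seq j) ?sub ?inE ?eqxx//= big1 ?addn0// => i /negPf.
  by rewrite eq_sym => ->.
(* A monomial of degree below [n] is already in [F n]; one of degree [n] is killed by the factor
   [n - size l]. *)
rewrite -scalerBl; have [ln'|] := ltnP (size l) n.
  by apply: (subspaceZ _ (F_subspace n)); apply: sub_span; exists l.
move=> nl; have -> : size l = n by apply/eqP; rewrite eqn_leq nl andbT.
rewrite subrr scale0r.
by exact: span0.
Qed.

(** Descent on the degree: a nonzero [D i x] replaces [x]. If all [D i x] vanish, [euler] puts [x]
    itself in a lower step of the filtration. *)
Lemma vacuum_generated x N : span (range monomial) x -> x != 0 ->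
  subspace N -> (forall i y, N y -> N (D i y)) -> N x -> N v.
Proof.
move=> /F_span[n Fx] x0 sN ND; elim: n x Fx x0 => [|n IH] x Fx x0 Nx.
  have : [set 0] x.
    apply: (@span_min _ _ _ [set 0]) Fx; last by move=> y [l].
    by split=> // a _ _ -> ->; rewrite scaler0 addr0.
  by move=> x00; rewrite x00 eqxx in x0.
have [Dx|/existsNP[i /eqP Dx]] := pselect (forall i, D i x = 0); last first.
  by apply: (IH (D i x)) => //; [exact: D_F|exact: ND].
(* At the bottom, where the Euler factor is zero, [x] is a nonzero multiple of [v]. *)
case: n IH Fx => [_ Fx|n IH Fx].
  have /span_set1[c xE] : span [set v] x.
    apply: span_min Fx; first exact: span_subspace.
    by move=> _ [[|//] _ <-]; exact: sub_span.
  have c0 : c != 0 by apply: contraNneq x0 => c0; rewrite xE c0 scale0r.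
  by rewrite -[v]scale1r -(mulVf c0) -scalerA -xE; exact: subspaceZ.
apply: (IH x) => //; rewrite -[x]scale1r -(@mulVf _ n.+1%:R) ?pnatr_eq0//.
by rewrite -scalerA; apply: (subspaceZ _ (F_subspace _)); exact: euler.
Qed.

End Vacuum.

(** * Decomposition into joint eigenvectors *)

Section OneVariable.
Variables (K : numFieldType) (V : lmodType K) (p q : {linear V -> V}).
Hypothesis pq : forall w, p (q w) = q (p w) + w.

(** For [n = 0] the value of [n.-1] is harmless, as its coefficient is zero. *)
Let p_iter n w : p (iter n q w) = iter n q (p w) + n%:R *: iter n.-1 q w.
Proof.
elim: n => [|n IH]; first by rewrite scale0r addr0.
rewrite iterS pq IH linearD linearZ /= -natr1 scalerDl scale1r addrA.
by case: n {IH} => [|n]; rewrite ?scale0r.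
Qed.

Let iterZ n a w : iter n q (a *: w) = a *: iter n q w.
Proof. by elim: n => //= n ->; rewrite linearZ. Qed.

Variable A : set V.
Hypotheses (A_subspace : subspace A) (Aq : forall w, A w -> A (q w)).

(** Eigenvectors are confined to [A], which will encode the eigenvalue conditions for the other
    indices, so that these are not lost. *)
Let B := span [set x | exists n u a, [/\ A u, p u = a *: u & x = iter n q u]].

Let B_subspace : subspace B.
Proof. exact: span_subspace. Qed.

Let sub_B n u a : A u -> p u = a *: u -> B (iter n q u).
Proof. by move=> Au pu; apply: sub_span; exists n, u, a. Qed.

Let B_A : B `<=` A.
Proof.
by apply: span_min => // _ [n [u [a [Au _ ->]]]]; elim: n => //= n; exact: Aq.
Qed.

(** If [p u = b *: u], then [p - a] sends q^n u to (b - a) q^n u + n q^(n-1) u. For [b = a] a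
    preimage of q^n u is q^(n+1) u divided by n + 1; otherwise the system is triangular and is
    solved by induction on [n]. *)
Let surjective_B a z : B z -> exists2 y, B y & p y - a *: y = z.
Proof.
pose T : {linear V -> V} := p \- (a \*: idfun).
move: z; apply: (@span_min _ _ _ [set z | exists2 y, B y & T y = z]).
  split; first by exists 0; [case: B_subspace|rewrite linear0].
  move=> b _ _ [y By <-] [y' By' <-]; exists (b *: y + y'); last by rewrite linearP.
  exact: B_subspace.2.
have TE y : T y = p y - a *: y by [].
have TZ c y : T (c *: y) = c *: T y by exact: linearZ.
have TB y y' : T (y - y') = T y - T y' by exact: linearB.
move=> _ [n [u [b [Au pu ->]]]].
have Tu m : T (iter m q u) = (b - a) *: iter m q u + m%:R *: iter m.-1 q u.
  by rewrite TE p_iter pu iterZ scalerBl addrAC.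
have [ba|ba] := eqVneq b a.
  exists (n.+1%:R^-1 *: iter n.+1 q u).
    by apply: (subspaceZ _ B_subspace); exact: sub_B pu.
  by rewrite TZ Tu ba subrr scale0r add0r scalerA mulVf ?scale1r ?pnatr_eq0.
have {}ba : b - a != 0 by rewrite subr_eq0.
have TV m : (b - a)^-1 *: (T (iter m q u) - m%:R *: iter m.-1 q u) = iter m q u.
  by rewrite Tu addrK scalerA mulVf ?scale1r.
elim: n => [|n [y By Ty]].
  exists ((b - a)^-1 *: u); first by apply: (subspaceZ _ B_subspace); exact: (sub_B 0 Au pu).
  by rewrite TZ -[RHS](TV 0%N) scale0r subr0.
exists ((b - a)^-1 *: (iter n.+1 q u - n.+1%:R *: y)).
  apply: (subspaceZ _ B_subspace); apply: (subspaceB B_subspace).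
    exact: sub_B pu.
  exact: (subspaceZ _ B_subspace).
by rewrite TZ TB TZ Ty -[RHS](TV n.+1).
Qed.

(* p - a maps B onto itself, so B contains w as soon as it contains
   (p - a) w. *)
Lemma annihilated_span w (s : seq K) : (forall w, A w -> A (p w)) -> A w ->
  foldl (fun w a => p w - a *: w) w s = 0 -> B w.
Proof.
move=> Ap; elim: s w => [|a s IH] w Aw /=; first by move->; case: B_subspace.
have Apw : A (p w - a *: w) by apply: (subspaceB A_subspace); [exact: Ap|exact: subspaceZ].
move=> /(IH _ Apw)/(surjective_B a)[y By yE].
(* [w - y] lies in [A] and is killed by [p - a], so it is a generator of [B] with exponent 0. *)
rewrite -(subrK y w); apply: (subspaceD B_subspace) => //.
apply: (@sub_B 0%N _ a); first by apply: (subspaceB A_subspace) => //; exact: B_A.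
by apply/eqP; rewrite linearB scalerBr subr_eq addrAC -addrA yE subrKC.
Qed.

End OneVariable.

(** By Cayley-Hamilton on a stable finite-dimensional subspace containing [w], a characteristic
    polynomial evaluated at [p] kills [w]. It splits over [K], and [s] lists its roots. *)
Lemma locally_finite_annihilated (K : closedFieldType) (V : lmodType K)
    (p : {linear V -> V}) w : locally_finite p ->
  exists s : seq K, foldl (fun w a => p w - a *: w) w s = 0.
Proof.
move=> /(_ w)[U [[t ->] [c _ <-] p_stable]].
have [n nE] : exists n, size t = n by exists (size t).
rewrite nE in c p_stable *; pose comb (r : 'rV[K]_n) := \sum_(i < n) r 0 i *: t`_i.
have comb_lin : linear comb.
  move=> a x y; rewrite /comb scaler_sumr -big_split; apply: eq_bigr => i _.
  by rewrite !mxE scalerDl scalerA.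
(* The spanning list [t] need not be free, so [M] is only a choice: its row [i] gives some
   coefficients of [p t_i]. *)
have [M pM] : exists M : 'M[K]_n, forall r, p (comb r) = comb (r *m M).
  have /fin_all_exists[m mE] (i : 'I_n) : exists r, p t`_i = comb r.
    have [|d _ dE] := p_stable t`_i.
      exists (fun j => (i == j)%:R) => //; rewrite (bigD1 i)//= eqxx scale1r.
      by rewrite big1 ?addr0// => j /negPf; rewrite eq_sym => ->; rewrite scale0r.
    exists (\row_j d j); rewrite -dE; apply: eq_bigr => j _; by rewrite mxE.
  exists (\matrix_i m i) => r; rewrite linear_sum.
  under eq_bigr do rewrite linearZ /= mE.
  rewrite mulmx_sum_row; have [f fE] := linear_bundle comb_lin.
  rewrite fE linear_sum; apply: eq_bigr => i _.
  by rewrite linearZ rowK.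
have -> : \sum_(i < n) c i *: t`_i = comb (\row_i c i).
  by apply: eq_bigr => i _; rewrite mxE.
move: (\row_i c i) => r {c p_stable nE}.
case: n => [|n] in comb comb_lin M pM r *; first by exists [::]; rewrite /= /comb big_ord0.
have [s sE] := closed_field_poly_normal (char_poly M); exists s.
(* Applying the operators [p - a] one after the other amounts, on coordinates, to evaluating the
   product of the factors X - a at [M]. *)
have H (x : seq K) (u : 'rV_n.+1) : foldl (fun w a => p w - a *: w) (comb u) x =
    comb (u *m horner_mx M (\prod_(a <- x) ('X - a%:P))).
  elim: x u => [|a x IH] u /=; first by rewrite big_nil rmorph1 mulmx1.
  have -> : p (comb u) - a *: comb u = comb (u *m (M - a%:M)).
    rewrite pM mulmxBr mul_mx_scalar; have [f ->] := linear_bundle comb_lin.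
    by rewrite [in RHS]linearB [in RHS]linearZ.
  by rewrite (IH (u *m (M - a%:M))) big_cons rmorphM -mulmxA rmorphB /= horner_mx_X horner_mx_C.
rewrite H; have := Cayley_Hamilton M.
rewrite sE (monicP (char_poly_monic M)) scale1r => ->.
by rewrite mulmx0 /comb big1 // => i _; rewrite mxE scale0r.
Qed.

Section JointEigenvectors.
Variables (K : numClosedFieldType) (V : lmodType K) (I : eqType).
Variables (P Q : I -> {linear V -> V}).

Definition joint_eigenvector (v : V) : Prop :=
  exists mu : I -> K, forall i, P i v = mu i *: v.

Hypothesis PP : forall i j w, P i (P j w) = P j (P i w).
Hypothesis PQ : forall i j w, P i (Q j w) = Q j (P i w) + (i == j)%:R *: w.
Hypothesis P_locally_finite : forall i, locally_finite (P i).

(** Induction on [s], the indices at which [w] is not yet known to be an eigenvector. *)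
Lemma span_joint_eigenvectors (s : seq I) (mu : I -> K) w :
  (forall j, j \notin s -> P j w = mu j *: w) ->
  span [set x | exists2 v, joint_eigenvector v & range (monomial Q v) x] w.
Proof.
elim: s mu w => [|i s IH] mu w Pw.
  by apply: sub_span; exists w; [exists mu => j; exact: Pw|exists [::]].
set N := span _ in IH *; have N_subspace : subspace N by exact: span_subspace.
(* For [j] outside [i :: s], [P j] commutes with [P i] and [Q i], so this common eigenspace is
   stable under both. *)
pose A : set V := [set w | forall j, j \notin i :: s -> P j w = mu j *: w].
have A_subspace : subspace A.
  split=> [j _|a x y Ax Ay j js]; first by rewrite linear0 scaler0.
  by rewrite linearP Ax// Ay// scalerDr !scalerA mulrC.
have AP x : A x -> A (P i x).
  by move=> Ax j js; rewrite PP Ax// linearZ.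
have AQ x : A x -> A (Q i x).
  move=> Ax j js; rewrite PQ Ax// linearZ.
  by move: js; rewrite inE => /norP[/negPf -> _]; rewrite scale0r addr0.
have PQi x : P i (Q i x) = Q i (P i x) + x by rewrite PQ eqxx scale1r.
have [t wt] := locally_finite_annihilated w (P_locally_finite i).
have := annihilated_span PQi A_subspace AQ AP Pw wt.
apply: (span_min N_subspace) => _ [n [u [a [Au Pu ->]]]].
(* [u] is also an eigenvector of [P i], so only the indices in [s] remain, with [mu] changed to [a]
   at [i]. *)
have Nu : N u.
  apply: (IH (fun j => if j == i then a else mu j)) => j js.
  by case: eqVneq => [->//|ji]; apply: Au; rewrite inE negb_or ji.
elim: n => //= n; move: (iter n (Q i) u) => x.
apply: span_stable => _ [v jv [l _ <-]]; apply: sub_span; exists v => //.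
by exists (i :: l).
Qed.

End JointEigenvectors.

(** * Semisimple modules *)

Section Semisimple.
Variables (K : fieldType) (L : lieAlgebra K) (W : lieModule L).
Implicit Types (U X Y : set W) (A : set (set W)).

Lemma lie_submoduleE U : lie_submodule U <->
  subspace U /\ forall x u, U u -> U (lie_act x u).
Proof.
split=> -[[U0 UL] UA]; split=> //; split.
- by move: U0; rewrite inE.
- by move=> a x y Ux Uy; have := UL a x y; rewrite !inE; apply.
- by rewrite inE.
- by move=> a x y; rewrite !inE => Ux Uy; exact: UL.
Qed.

Lemma lie_submoduleI U X : lie_submodule U -> lie_submodule X ->
  lie_submodule (U `&` X).
Proof.
move=> /lie_submoduleE[sU aU] /lie_submoduleE[sX aX]; apply/lie_submoduleE.
by split; [exact: subspaceI|move=> x u [Uu Xu]; split; auto].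
Qed.

Lemma lie_submodule_span A : (forall X, A X -> lie_submodule X) ->
  lie_submodule (span (\bigcup_(X in A) X)).
Proof.
move=> Asub; apply/lie_submoduleE; split; first exact: span_subspace.
move=> x; apply: span_stable => u [X AX Xu]; apply: sub_span; exists X => //.
by have /lie_submoduleE[_] := Asub _ AX; apply.
Qed.

(** This form of directness is of finite character, which suits Zorn's lemma. *)
Definition independent A : Prop := forall X w,
  A X -> X w -> span (\bigcup_(Y in A `\ X) Y) w -> w = 0.

(** A vector of the span involves finitely many submodules, and these all lie in one member of the
    chain. *)
Lemma independent_bigcup (F : set (set (set W))) :
  F `<=` independent -> total_on F subset ->
  independent (\bigcup_(A in F) A).
Proof.
move=> Find Ftot X w [A0 FA0 A0X] Xw Sw.
have [A [FA AX Aw]] : exists A, [/\ F A, A X & span (\bigcup_(Y in A `\ X) Y) w].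
  have mono A A' : A `<=` A' -> span (\bigcup_(Y in A `\ X) Y) `<=`
      span (\bigcup_(Y in A' `\ X) Y).
    move=> AA'; apply: span_sub => x [Y [AY YX] Yx].
    by exists Y => //; split; [exact: AA'|].
  move: w Sw {Xw}; apply: span_min.
    split; first by exists A0; split=> //; exact: span0.
    move=> a x y [A [FA AX Ax]] [A' [FA' AX' Ay]].
    have [AA'|AA'] := Ftot _ _ FA FA'.
      by exists A'; split=> //; apply: (span_subspace _).2 => //; exact: mono Ax.
    by exists A; split=> //; apply: (span_subspace _).2 => //; exact: mono Ay.
  move=> x [Y [[A FA AY] YX] Yx].
  have [AA0|A0A] := Ftot _ _ FA FA0.
    exists A0; split=> //; apply: sub_span; exists Y => //; split=> //.
    exact: AA0.
  exists A; split=> //; first exact: A0A.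
  by apply: sub_span; exists Y.
exact: Find Aw.
Qed.

(** Split [w] in a member [Y] of [A] as [y + z], with [y] from the other members of [A] and [z] in
    [X]. Then [z = w - y] is in [X] and in the span of [A], hence zero, and independence of [A]
    applies. *)
Lemma independent_setU1 A X : independent A -> subspace X ->
  (forall w, X w -> span (\bigcup_(Y in A) Y) w -> w = 0) ->
  independent (X |` A).
Proof.
move=> Aind sX X0 Y w; have [->|YX] := pselect (Y = X).
  move=> _ Xw Sw; apply: X0 => //; apply: span_sub Sw => x [Z [[->|AZ] ZX] Zx]; first by case: ZX.
  by exists Z.
move=> [//|AY] Yw Sw.
have /(span_setU sX)[y [z [Sy Xz wE]]] :
    span ((\bigcup_(Z in A `\ Y) Z) `|` X) w.
  apply: span_sub Sw => x [Z [[->|AZ] ZY] Zx]; first by right.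
  by left; exists Z.
have z0 : z = 0.
  apply: X0 => //; have -> : z = w - y by rewrite wE addrC addKr.
  apply: (subspaceB (span_subspace _)); first by apply: sub_span; exists Y.
  by apply: span_sub Sy => x [Z [AZ _] Zx]; exists Z.
by apply: (Aind Y) => //; rewrite wE z0 addr0.
Qed.

Lemma fsbig_setT_supp (J : choiceType) (D : set J) (u : J -> W) :
  finite_set D -> [set j | u j != 0] `<=` D ->
  \sum_(j \in [set: J]) u j = \sum_(j <- fset_set D) u j.
Proof.
move=> fD uD; rewrite -(fsbig_widen D)//; first exact: fsbig_finite.
by move=> j [_ Dj] /=; apply/eqP/negPn/negP => uj; case: Dj; exact: uD.
Qed.

Lemma independent_direct_sum A w : independent A ->
  (forall X, A X -> subspace X) -> span (\bigcup_(X in A) X) w ->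
  exists! u : A -> W, [/\ forall j, (\val j : set W) (u j),
    finite_set [set j | u j != 0] & w = \sum_(j \in [set: A]) u j].
Proof.
move=> Aind Asub Sw.
have AP (j : A) : A (\val j) by exact: set_valP.
have suppD (D D' : set A) a (u u' : A -> W) : [set j | u j != 0] `<=` D ->
    [set j | u' j != 0] `<=` D' ->
    [set j | a *: u j + u' j != 0] `<=` D `|` D'.
  move=> uD uD' j /=; have [uj0|/uD] := eqVneq (u j) 0; last by left.
  by rewrite uj0 scaler0 add0r => /uD'; right.
apply/unique_existence; split; last first.
  move=> u u' [Uu fu uE] [Uu' fu' uE']; apply/funext => j; apply/eqP.
  rewrite -subr_eq0; apply/eqP.
  pose D := [set j | u j != 0] `|` [set j | u' j != 0].
  have fD : finite_set D by rewrite finite_setU.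
  have : \sum_(k <- fset_set D) (u k - u' k) = 0.
    by rewrite sumrB -!fsbig_setT_supp -?uE -?uE' ?subrr// => k; [right|left].
  have [Dj|nDj _] := pselect (D j); last first.
    apply/eqP; rewrite subr_eq0; apply/negPn/negP => uu'; apply: nDj.
    have [uj0|] := eqVneq (u j) 0; last by left.
    by right => /=; apply: contraNneq uu' => ->; rewrite uj0.
  rewrite (bigD1_seq j)/= ?fset_uniq//; last by rewrite in_fset_set// inE.
  move=> /eqP; rewrite addr_eq0 => /eqP uE0.
  (* [u j - u' j] is minus the sum of the other differences, hence in the span of the other
     submodules. *)
  apply: (Aind (\val j)) => //; first exact: subspaceB (Asub _ (AP j)) _ _.
  rewrite uE0 -scaleN1r; apply: (subspaceZ _ (span_subspace _)).
  rewrite big_mkcond; apply: (subspace_sum (span_subspace _)) => k _.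
  case: ifPn => kj; last exact: span0.
  apply: sub_span; exists (\val k); last exact: subspaceB (Asub _ (AP k)) _ _.
  by split=> // /val_inj; apply/eqP.
move: w Sw; apply: span_min.
  split.
    exists (fun=> 0); split=> [j||]; first by have [] := Asub _ (AP j).
      by rewrite (_ : mkset _ = set0)// -subset0 => j /=; rewrite eqxx.
    by rewrite fsbig1.
  move=> a x y [u [Uu fu ->]] [u' [Uu' fu' ->]].
  exists (fun j => a *: u j + u' j); split=> [j||].
  - exact: (Asub _ (AP j)).2.
  - by apply: sub_finite_set (suppD _ _ a _ _ (fun j => id) (fun j => id)) _; rewrite finite_setU.
  pose D := [set j | u j != 0] `|` [set j | u' j != 0].
  have fD : finite_set D by rewrite finite_setU.
  rewrite !(fsbig_setT_supp fD); first by rewrite scaler_sumr big_split.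
  - exact: suppD.
  - by move=> k; right.
  - by move=> k; left.
move=> x [X AX Xx]; pose j0 : A := SigSub (mem_set AX).
exists (fun j => if j == j0 then x else 0).
have supp : [set j | (if j == j0 then x else 0) != 0] `<=` [set j0].
  by move=> j /=; case: (eqVneq j j0) => [//|_]; rewrite eqxx.
split=> [j||].
- by case: eqVneq => [->//|_]; have [] := Asub _ (AP j).
- exact: sub_finite_set supp (finite_set1 _).
by rewrite (fsbig_setT_supp _ supp)// fset_set1 big_seq_fset1 eqxx.
Qed.

(** Take a maximal independent set [A] of irreducible submodules. An irreducible [X] meets the span
    of [A] in 0 or in [X]; in the first case, if not in [A] already, it could be added to [A]. *)
Lemma completely_reducible_span :
  (forall w, span (\bigcup_(X in @irreducible_submodule K L W) X) w) ->
  completely_reducible W.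
Proof.
move=> Wspan.
pose P A := A `<=` @irreducible_submodule K L W /\ independent A.
have [A [[Airr Aind] Amax]] : exists A, P A /\ forall B, A `<` B -> ~ P B.
  apply: Zorn_bigcup => F FP Ftot; split; first by move=> X [A /FP[Airr _]]; exact: Airr.
  by apply: independent_bigcup => // A /FP[].
have Asub X : A X -> subspace X.
  by move=> /Airr[/lie_submoduleE[]].
have Aspan w : span (\bigcup_(X in A) X) w.
  apply: span_min (Wspan w); first exact: span_subspace.
  move=> x [X Xirr Xx]; have [sX X0 Xmin] := Xirr.
  have SA : lie_submodule (span (\bigcup_(X in A) X)).
    by apply: lie_submodule_span => Y /Airr[].
  have [XS0|XS] := Xmin _ (lie_submoduleI sX SA) (@subIsetl _ _ _); last first.
    by move: Xx; rewrite -XS => -[].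
  have [AX|nAX] := pselect (A X); first by apply: sub_span; exists X.
  exfalso; apply: (Amax (X |` A)).
    by split=> [|XA]; [exact: subsetUr|apply: nAX; apply: XA; left].
  split; first by move=> Y [->//|]; exact: Airr.
  apply: independent_setU1 => //; first by have /lie_submoduleE[] := sX.
  by move=> y Xy Sy; have : [set 0] y by rewrite -XS0.
exists A, (fun j => \val j); split=> [j|w]; first exact/Airr/set_valP.
exact: independent_direct_sum.
Qed.

End Semisimple.

(** * Heisenberg modules generated by a joint eigenvector *)

(** Lets the vacuum argument run on the product of two modules. *)
Definition pair_map (K : fieldType) (U V : lmodType K) (f : U -> U) (g : V -> V)
  (x : U * V) : U * V := (f x.1, g x.2).

Section PairMap.
Variables (K : fieldType) (U V : lmodType K).
Variables (f : {linear U -> U}) (g : {linear V -> V}).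

Fact pair_map_linear : linear (pair_map f g).
Proof. by move=> a x y; congr pair; rewrite /= linearP. Qed.

HB.instance Definition _ := GRing.isLinear.Build K (U * V)%type (U * V)%type
  _ (pair_map f g) pair_map_linear.

End PairMap.

Section HeisenbergOperators.
Variables (R : realType) (I : choiceType) (W : lieModule (heis R I)).

Lemma heis_actE (x : heis R I) (w : W) :
  lie_act x w = lincomb x (fun t => lie_act (delta R[i] t : heis R I) w).
Proof.
rewrite {1}[x]heis_basis.
apply: (lincomb_linear (f := fun y : heis R I => lie_act y w)).
by move=> a y z; rewrite linearPl.
Qed.

Definition p_op i : {linear W -> W} := lie_act (heis_p R i).
Definition q_op i : {linear W -> W} := lie_act (heis_q R i).

Lemma p_opC i j w : p_op i (p_op j w) = p_op j (p_op i w).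
Proof.
by apply/eqP; rewrite -subr_eq0 -lie_actB heis_ppE linear0l.
Qed.

Lemma q_opC i j w : q_op i (q_op j w) = q_op j (q_op i w).
Proof.
by apply/eqP; rewrite -subr_eq0 -lie_actB heis_qqE linear0l.
Qed.

Hypothesis W_level : heis_level W 1.

Lemma pq_op i j w :
  p_op i (q_op j w) = q_op j (p_op i w) + (i == j)%:R *: w.
Proof.
apply/eqP; rewrite addrC -subr_eq -lie_actB heis_pqE linearZl_LR /=.
by rewrite W_level scale1r.
Qed.

Lemma heis_submodule (U : set W) : subspace U ->
  (forall i w, U w -> U (p_op i w)) -> (forall i w, U w -> U (q_op i w)) ->
  lie_submodule U.
Proof.
move=> sU Up Uq; apply/lie_submoduleE; split=> // x u Uu; rewrite heis_actE.
have [s ->] := lincombP W x; apply: (subspace_sum sU) => t _.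
apply: (subspaceZ _ sU); case: t => [[i|i]|[]]; [exact: Up|exact: Uq|].
by rewrite -[delta _ _]/(heis_k R I) W_level scale1r.
Qed.

(** The shift turns a joint eigenvector with eigenvalues [mu] into a vacuum vector and keeps the
    commutators with the [q_op j]. *)
Definition vacuum_op (mu : I -> R[i]) i : {linear W -> W} :=
  p_op i \- (mu i \*: idfun).

Lemma vacuum_qE mu i j w :
  vacuum_op mu i (q_op j w) = q_op j (vacuum_op mu i w) + (i == j)%:R *: w.
Proof.
rewrite -[LHS]/(p_op i (q_op j w) - mu i *: q_op j w).
rewrite -[vacuum_op mu i w]/(p_op i w - mu i *: w) pq_op.
by rewrite [in RHS]linearB [in RHS]linearZ addrAC.
Qed.

Lemma p_opE mu i w : p_op i w = vacuum_op mu i w + mu i *: w.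
Proof. by rewrite -[vacuum_op mu i w]/(p_op i w - mu i *: w) subrK. Qed.

Lemma cyclic_submodule v : joint_eigenvector p_op v ->
  lie_submodule (span (range (monomial q_op v))).
Proof.
move=> [mu vmu]; apply: heis_submodule; first exact: span_subspace.
  move=> i w vw; rewrite (p_opE mu); apply: (subspaceD (span_subspace _)).
    apply: (span_monomial_D (vacuum_qE mu)) => // j.
    by rewrite -[LHS]/(p_op j v - mu j *: v) vmu subrr.
  exact: (subspaceZ _ (span_subspace _)).
by move=> i w; exact: span_monomial_Q.
Qed.

Lemma cyclic_irreducible v : joint_eigenvector p_op v -> v != 0 ->
  irreducible_submodule (span (range (monomial q_op v))).
Proof.
move=> jv v0; have [mu vmu] := jv; split; first exact: cyclic_submodule.
  move=> S0; have : span (range (monomial q_op v)) v by apply: sub_span; exists [::].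
  by rewrite S0 => /eqP; rewrite (negPf v0).
move=> U /lie_submoduleE[sU UA] Uv.
have [U0|/existsNP[w /not_implyP[Uw w0]]] := pselect (forall w, U w -> w = 0).
  left; apply/seteqP; split=> [w /U0 //|_ ->]; exact: sU.1.
right; apply/seteqP; split=> //.
have Uv0 : U v.
  apply: (vacuum_generated (vacuum_qE mu) _ q_opC (Uv _ Uw)) => //.
  - by move=> j; rewrite -[LHS]/(p_op j v - mu j *: v) vmu subrr.
  - exact/eqP.
  move=> i y Uy; apply: (subspaceB sU); [exact: UA|exact: (subspaceZ _ sU)].
apply: span_min => // _ [l _ <-]; elim: l => //= i l; exact: UA.
Qed.

End HeisenbergOperators.

Arguments p_op {R I} W i.
Arguments q_op {R I} W i.
Arguments vacuum_op {R I} W mu i.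

(** * Modules generated by joint eigenvectors with equal eigenvalues *)

Section CyclicIsomorphism.
Variables (R : realType) (I : choiceType) (V W : lieModule (heis R I)).
Hypotheses (V_level : heis_level V 1) (W_level : heis_level W 1).
Variables (mu : I -> R[i]) (v : V) (w : W).
Hypotheses (v0 : v != 0) (w0 : w != 0).
Hypotheses (v_mu : forall i, p_op V i v = mu i *: v)
  (w_mu : forall i, p_op W i w = mu i *: w).
Hypotheses (v_gen : forall x, span (range (monomial (q_op V) v)) x)
  (w_gen : forall y, span (range (monomial (q_op W) w)) y).

Let Q i : {linear (V * W)%type -> (V * W)%type} := pair_map (q_op V i) (q_op W i).
Let D i : {linear (V * W)%type -> (V * W)%type} :=
  pair_map (vacuum_op V mu i) (vacuum_op W mu i).

(* The submodule of V * W generated by (v, w); it is the graph of the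
   isomorphism. *)
Let graph (x : V) (y : W) : Prop := span (range (monomial Q (v, w))) (x, y).

Let DQ i j z : D i (Q j z) = Q j (D i z) + (i == j)%:R *: z.
Proof. by case: z => x y; congr pair; exact: vacuum_qE. Qed.

Let Dvw i : D i (v, w) = 0.
Proof.
congr pair; first by rewrite -[LHS]/(p_op V i v - mu i *: v) v_mu subrr.
by rewrite -[LHS]/(p_op W i w - mu i *: w) w_mu subrr.
Qed.

Let QQ i j z : Q i (Q j z) = Q j (Q i z).
Proof. by case: z => x y; congr pair; exact: q_opC. Qed.

Let graph_lin a x x' y y' : graph x y -> graph x' y' ->
  graph (a *: x + x') (a *: y + y').
Proof. exact: (span_subspace _).2. Qed.

Let graphB x x' y y' : graph x y -> graph x' y' -> graph (x - x') (y - y').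
Proof. exact: (subspaceB (span_subspace _)). Qed.

Let monomial_pair l :
  monomial Q (v, w) l = (monomial (q_op V) v l, monomial (q_op W) w l).
Proof. by elim: l => //= i l ->. Qed.

Let graph_total x : exists y, graph x y.
Proof.
apply: (span_min (N := [set x | exists y, graph x y])) (v_gen x).
  split; first by exists 0; exact: span0.
  by move=> a x1 x2 [y1 g1] [y2 g2]; exists (a *: y1 + y2); exact: graph_lin.
move=> _ [l _ <-]; exists (monomial (q_op W) w l); by apply: sub_span; exists l.
Qed.

Let graph_surj y : exists x, graph x y.
Proof.
apply: (span_min (N := [set y | exists x, graph x y])) (w_gen y).
  split; first by exists 0; exact: span0.
  by move=> a y1 y2 [x1 g1] [x2 g2]; exists (a *: x1 + x2); exact: graph_lin.
move=> _ [l _ <-]; exists (monomial (q_op V) v l); by apply: sub_span; exists l.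
Qed.

(** If [y] were nonzero, [vacuum_generated] applied to [(0, y)] and to the [D]-stable subspace of
    pairs with first component 0 would give [v = 0]. *)
Let graph0r y : graph 0 y -> y = 0.
Proof.
move=> g0y; apply/eqP/negPn/negP => y0; move: v0 => /eqP; apply.
apply: (vacuum_generated DQ Dvw QQ g0y (N := [set z | z.1 = 0])) => //.
- by apply: contraNneq y0 => /(congr1 snd) /= ->.
- by split=> // a x1 x2 /= -> ->; rewrite scaler0 addr0.
- by move=> i z /= ->; exact: (linear0 (vacuum_op V mu i)).
Qed.

Let graph0l x : graph x 0 -> x = 0.
Proof.
move=> gx0; apply/eqP/negPn/negP => x0; move: w0 => /eqP; apply.
apply: (vacuum_generated DQ Dvw QQ gx0 (N := [set z | z.2 = 0])) => //.
- by apply: contraNneq x0 => /(congr1 fst) /= ->.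
- by split=> // a x1 x2 /= -> ->; rewrite scaler0 addr0.
- by move=> i z /= ->; exact: (linear0 (vacuum_op W mu i)).
Qed.

Let graph_fun x y y' : graph x y -> graph x y' -> y = y'.
Proof.
move=> gy gy'; apply/eqP; rewrite -subr_eq0; apply/eqP/graph0r.
by rewrite -(subrr x); exact: graphB.
Qed.

Let graph_inj x x' y : graph x y -> graph x' y -> x = x'.
Proof.
move=> gx gx'; apply/eqP; rewrite -subr_eq0; apply/eqP/graph0l.
by rewrite -(subrr y); exact: graphB.
Qed.

Let graph_q i x y : graph x y -> graph (q_op V i x) (q_op W i y).
Proof. exact: (span_monomial_Q (Q := Q) i). Qed.

Let graph_p i x y : graph x y -> graph (p_op V i x) (p_op W i y).
Proof.
move=> gxy; rewrite !(p_opE mu) ![_ + mu i *: _]addrC; apply: graph_lin => //.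
exact: (span_monomial_D DQ Dvw i gxy).
Qed.

Lemma cyclic_isomorphic : lie_isomorphic V W.
Proof.
(* [graph] is total and single-valued in both directions, so the chosen maps are mutually
   inverse. *)
have [f fP] := choice graph_total; have [g gP] := choice graph_surj.
have lf : linear f.
  by move=> a x y; apply: graph_fun (fP _) _; exact: graph_lin.
have [h hE] := linear_bundle lf; exists h; rewrite -hE; split.
  exists g; first by move=> x; exact: graph_inj (gP _) (fP _).
  by move=> y; exact: graph_fun (fP _) (gP _).
move=> x u; rewrite !heis_actE (lincomb_linear _ _ lf); congr lincomb.
apply/funext => -[[i|i]|[]] /=.
- by apply: graph_fun (fP _) _; exact: graph_p.
- by apply: graph_fun (fP _) _; exact: graph_q.
rewrite -[delta _ _]/(heis_k R I) V_level W_level !scale1r//.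
Qed.

End CyclicIsomorphism.

(** * M(1, lambda) as a module generated by a joint eigenvector *)

Section ExponentialModule.
Variables (R : realType) (I : choiceType) (lam : F0 R[i] I).

Fact exp_lambda_subproof : (exp_lambda lam : _ -> R[i]^o) \in M1_pred lam.
Proof.
apply/asboolP; exists (fun=> 1); first exact: polynomial_const.
by apply/funext => x; rewrite mulr1.
Qed.

Definition M1_exp : M1 lam := MkM1 exp_lambda_subproof.

Lemma M1_exp_neq0 : M1_exp != 0.
Proof.
apply/eqP => /(congr1 (fun f : M1 lam => M1_val f 0)); apply/eqP.
rewrite -[_ == _]/(exp_lambda lam 0 == 0) /exp_lambda fsbig1 => [|i _]; last exact: mulr0.
by rewrite cexp0 oner_eq0.
Qed.

Lemma M1_exp_eigenvector i : p_op (M1 lam) i M1_exp = lam i *: M1_exp.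
Proof.
by rewrite [LHS]M1_pE; apply: val_inj; exact: is_partialE (exp_lambda_partial _ _).
Qed.

Lemma M1_level : heis_level (M1 lam) 1.
Proof. by move=> f; rewrite M1_kE scale1r. Qed.

Lemma M1_exp_generates (f : M1 lam) :
  span (range (monomial (q_op (M1 lam)) M1_exp)) f.
Proof.
set S := span _; have sS : subspace S by exact: span_subspace.
have [P pP fE] : exp_polynomial (exp_lambda lam) (M1_val f).
  exact/asboolP/(M1_valP f).
(* Multiplication by [P] preserves [S]. The quantification over [g] lets a product of polynomials be
   treated as two successive multiplications. *)
have SP : forall g : M1 lam, S g -> exists2 h : M1 lam, S h &
    forall x, M1_val h x = P x * M1_val g x.
  elim: pP => [c|i|P1 P2 _ IH1 _ IH2|P1 P2 _ IH1 _ IH2] g Sg.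
  - by exists (c *: g) => //; exact: (subspaceZ _ sS).
  - by exists (q_op _ i g); [exact: span_monomial_Q|move=> x; rewrite [q_op _ _ _]M1_qE].
  - have [h1 S1 h1E] := IH1 _ Sg; have [h2 S2 h2E] := IH2 _ Sg.
    exists (h1 + h2); first exact: (subspaceD sS).
    by move=> x; rewrite mulrDl -h1E -h2E.
  - have [h2 S2 h2E] := IH2 _ Sg; have [h1 S1 h1E] := IH1 _ S2.
    by exists h1 => // x; rewrite h1E h2E mulrA.
have [|h Sh hE] := SP M1_exp; first by apply: sub_span; exists [::].
suff -> : f = h by [].
by apply/val_inj/funext => x /=; rewrite hE fE mulrC.
Qed.

End ExponentialModule.

(** * Modules in the category F *)

Section CategoryFTheory.
Variables (R : realType) (I : choiceType) (W : lieModule (heis R I)).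
Hypothesis WF : category_F W.

(** Restrictedness makes [w] an eigenvector, of eigenvalue 0, of all but finitely many
    [p_op W i]. *)
Lemma category_F_span (w : W) : span [set x | exists2 v,
  joint_eigenvector (p_op W) v & range (monomial (q_op W) v) x] w.
Proof.
have [Wres Wlev Wlf] := WF.
have /finite_seqP[s sE] := Wres w.
apply: (span_joint_eigenvectors (@p_opC _ _ W) (pq_op Wlev) Wlf (s := s) (mu := fun=> 0)) => j js.
rewrite scale0r; apply/eqP/negPn; apply: contraNN js => pw.
by have : [set` s] j by rewrite -sE.
Qed.

Lemma category_F_completely_reducible : completely_reducible W.
Proof.
apply: completely_reducible_span => w; have [_ Wlev _] := WF.
apply: span_min (category_F_span w); first exact: span_subspace.
(* [joint_eigenvector] admits the zero vector, which generates no irreducible submodule; its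
   monomials vanish. *)
move=> x [v jv [l _ <-]]; have [->|v0] := eqVneq v 0.
  rewrite (_ : monomial _ _ _ = 0); first exact: span0.
  by elim: l => //= i l ->; rewrite linear0.
apply: sub_span; exists (span (range (monomial (q_op W) v))).
  exact: cyclic_irreducible.
by apply: sub_span; exists l.
Qed.

Lemma category_F_irreducible_isomorphic : lie_irreducible W ->
  exists lam : F0 R[i] I, lie_isomorphic W (M1 lam).
Proof.
move=> [_ W0 Wmin]; have [Wres Wlev _] := WF.
(* Otherwise all the spanning monomials vanish, and [W] with them. *)
have [v jv v0] : exists2 v, joint_eigenvector (p_op W) v & v != 0.
  apply: contrapT => nv; apply: W0; apply/seteqP; split=> // w _.
  apply: span_min (category_F_span w).
    by split=> // a _ _ -> ->; rewrite scaler0 addr0.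
  move=> _ [v jv [l _ <-]]; have [->|v0] := eqVneq v 0.
    by elim: l => //= i l ->; rewrite linear0.
  by case: nv; exists v.
have [mu vmu] := jv.
(* A nonzero [mu i] forces [p_op W i v] to be nonzero, which restrictedness allows for finitely many
   [i] only. *)
have mu_fin : (mu : I -> R[i]^o) \in @Defs.finsupp R[i] I.
  apply/asboolP; apply: sub_finite_set (Wres v) => i /= mui.
  by rewrite [lie_act _ _]vmu scaler_eq0 negb_or mui.
exists (MkF0 mu_fin).
apply: (cyclic_isomorphic Wlev (@M1_level _ _ _) v0 (M1_exp_neq0 _) vmu).
- exact: M1_exp_eigenvector.
(* The submodule generated by [v] contains [v], hence is nonzero, and irreducibility makes it all of
   [W]. *)
- move=> x; have [S0|->//] := Wmin _ (cyclic_submodule Wlev jv) (@subsetT _ _).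
  have : span (range (monomial (q_op W) v)) v by apply: sub_span; exists [::].
  by rewrite S0 => /eqP; rewrite (negPf v0).
- exact: M1_exp_generates.
Qed.

End CategoryFTheory.

Theorem theorem2p7 (R : realType) (I : choiceType) (I_nonempty : inhabited I) :
  (forall W : lieModule (heis R I), category_F W -> lie_irreducible W ->
     exists lam : F0 R[i] I, lie_isomorphic W (M1 lam)) /\
  (forall W : lieModule (heis R I), category_F W -> completely_reducible W).
Proof.
split=> W WF; first exact: category_F_irreducible_isomorphic.
exact: category_F_completely_reducible.
Qed.
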